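(* Suppose that $T \in M_3(\mathbb{C})$ has distinct eigenvalues $\lambda_1,\lambda_2,\lambda_3$ with corresponding unit eigenvectors $x_1,x_2,x_3$. Let $y_1,y_2,y_3$ denote unit eigenvectors of $T^*$ corresponding to the eigenvalues $\overline{\lambda_1},\overline{\lambda_2},\overline{\lambda_3}$. Then $T$ is UECSM if and only if $$|\langle x_i,x_j\rangle| = |\langle y_i,y_j\rangle| \qquad \text{for all } 1\le i<j\le 3.$$
   Context: $\langle\cdot,\cdot\rangle$ is the standard inner product on $\mathbb{C}^3$, and $T^*$ is the conjugate transpose of $T$. Two matrices $A,B\in M_n(\mathbb{C})$ are unitarily equivalent if $A = UBU^*$ for some unitary matrix $U$. A matrix $T \in M_n(\mathbb{C})$ is called UECSM if it is unitarily equivalent to a complex symmetric matrix, i.e. a matrix $S \in M_n(\mathbb{C})$ with $S = S^t$ (transpose without conjugation). *)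

(* Defs.v *)
From mathcomp Require Import all_boot all_order all_algebra.
From mathcomp Require Import reals.
From mathcomp.real_closed Require Import complex.

Set Implicit Arguments.
Unset Strict Implicit.
Unset Printing Implicit Defensive.

Import Order.TTheory GRing.Theory Num.Theory.
Local Open Scope ring_scope.
Local Open Scope sesquilinear_scope.

(* [dotmx] takes row vectors; it is linear in its first argument and
   conjugate-linear in its second. *)
Definition inner (C : numClosedFieldType) n (u v : 'cV[C]_n) : C :=
  dotmx u^T v^T.

Definition vnorm (C : numClosedFieldType) n (u : 'cV[C]_n) : C :=
  sqrtC (inner u u).

(* The library's [eigenvalue] and [eigenspace] concern the action of a matrix
   on row vectors; here [T] acts on column vectors. The vector [v] is nonzero
   because its norm is 1. *)
Definition unit_eigenvector (C : numClosedFieldType) n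
    (T : 'M[C]_n) (a : C) (v : 'cV[C]_n) : Prop :=
  T *m v = a *: v /\ vnorm v = 1.

Definition unitarily_equivalent (C : numClosedFieldType) n
    (A B : 'M[C]_n) : Prop :=
  exists2 U : 'M[C]_n, U \is unitarymx & A = U *m B *m U^t*.

Definition UECSM (C : numClosedFieldType) n (T : 'M[C]_n) : Prop :=
  exists2 S : 'M[C]_n, S = S^T & unitarily_equivalent T S.

(* Main.v *)
(* [T] is UECSM iff [T^* V = V conj(T)] for some symmetric unitary [V]: if
   [T = U S U^*] take [V = U U^T]; conversely a symmetric unitary [V] factors
   as [W W^T] with [W] unitary, and then [W^* T W] is symmetric.

   Let [X], [Y] have the eigenvectors as columns. As the eigenvalues are
   distinct, [X^* Y] is diagonal and such a [V] must satisfy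
   [V conj(X) = Y B] with [B] diagonal. So [T] is UECSM iff the Gram matrices
   [G = X^* X] and [H = Y^* Y] satisfy [conj(G) = B^* H B] for a diagonal [B].
   This forces equal moduli of the entries. Conversely, such a [B] exists for
   matrices of size 3 as soon as the moduli agree and the product
   [H_01 H_12 H_20] is conjugate to [t = G_01 G_12 G_20]. The latter is
   automatic: [H] is a diagonal rescaling of the inverse of [G], and writing
   [a], [b], [c] for the squared moduli of the entries of [G], the equality
   [|H_01| = |G_01|] becomes [t + conj(t) = ab + bc + ca - abc]. Substituting
   this in the expansion of [H_01 H_12 H_20] gives [conj(t)]. *)

Require Import Defs.
From mathcomp Require Import all_boot all_order all_algebra.
From mathcomp Require Import reals ring.
From mathcomp.real_closed Require Import complex.

Set Implicit Arguments.
Unset Strict Implicit.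
Unset Printing Implicit Defensive.

Import Order.TTheory GRing.Theory Num.Theory.
Local Open Scope ring_scope.
Local Open Scope sesquilinear_scope.

Local Notation "M ^c" := (map_mx Num.conj M) : sesquilinear_scope.

(** * Algebraic identities for a 3 by 3 Gram matrix and its rescaled inverse *)

(* Cramer's rule for [h *m G = (d, 0, 0)], where [G] is the matrix
   [[1, p, r'], [p', 1, q], [r, q', 1]] of determinant [Delta]. *)
Lemma cramer3 (R : comPzRingType) (p p' q q' r r' h0 h1 h2 d : R)
    (Delta := 1 - p * p' - q * q' - r * r' + p * q * r + p' * q' * r') :
  h0 + h1 * p' + h2 * r = d -> h0 * p + h1 + h2 * q' = 0 ->
  h0 * r' + h1 * q + h2 = 0 ->
  h0 * Delta = d * (1 - q * q') /\ h1 * Delta = d * (r' * q' - p).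
Proof.
move=> <- e1 e2.
split; apply/eqP; rewrite -subr_eq0; apply/eqP.
  rewrite (_ : _ - _ = (h0 * p + h1 + h2 * q') * (r * q - p')
                     + (h0 * r' + h1 * q + h2) * (p' * q' - r)).
    by rewrite e1 e2 !mul0r addr0.
  by rewrite /Delta; ring.
rewrite (_ : _ - _ = (h0 * p + h1 + h2 * q') * (1 - r * r')
                   + (h0 * r' + h1 * q + h2) * (p * r - q')).
  by rewrite e1 e2 !mul0r addr0.
by rewrite /Delta; ring.
Qed.

(* The primed variables stand for complex conjugates. *)
Lemma dual_triple_product (F : fieldType)
    (p p' q q' r r' u u' v w d0 d0' d1 d1' d2 : F) :
  d0 != 0 -> d1 != 0 -> d2 != 0 ->
  1 - p * p' != 0 -> 1 - q * q' != 0 -> 1 - r * r' != 0 ->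
  d0 * d0' * (1 - q * q') = d1 * d1' * (1 - r * r') -> d1' != 0 ->
  u * (d1 * (1 - r * r')) = d0 * (r' * q' - p) ->
  u' * (d1' * (1 - r * r')) = d0' * (r * q - p') ->
  v * (d2 * (1 - p * p')) = d1 * (p' * r' - q) ->
  w * (d0 * (1 - q * q')) = d2 * (q' * p' - r) ->
  p * p' = u * u' -> u * v * w = p' * q' * r'.
Proof.
move=> d0_neq0 d1_neq0 d2_neq0 p_neq q_neq r_neq dd d1'_neq0 eu eu' ev ew puu'.
(* Inserting the formulas for [u] and [u'] into [p * p' = u * u'] and cancelling the [d]s by [dd]
   gives the relation on t + conj(t), not yet expanded. *)
have norm_p : p * p' * (1 - q * q') * (1 - r * r') = (r' * q' - p) * (r * q - p').
  have d_neq0 : d1 * d1' * (1 - r * r') != 0 by rewrite !mulf_neq0.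
  apply: (mulIf d_neq0).
  transitivity ((u * (d1 * (1 - r * r'))) * (u' * (d1' * (1 - r * r'))) * (1 - q * q')).
    by rewrite puu'; ring.
  by rewrite eu eu' -dd; ring.
have d_neq0 : d1 * (1 - r * r') * (d2 * (1 - p * p')) * (d0 * (1 - q * q')) != 0.
  by rewrite !mulf_neq0.
apply: (mulIf d_neq0).
transitivity ((u * (d1 * (1 - r * r'))) * (v * (d2 * (1 - p * p')))
              * (w * (d0 * (1 - q * q')))); first by ring.
rewrite eu ev ew; apply/eqP; rewrite -subr_eq0; apply/eqP.
move/eqP: norm_p; rewrite -subr_eq0 => /eqP norm_p.
(* The difference of the two sides is [norm_p] times the cofactor conj(t) - 1, up to the [d]s. *)
transitivity (d0 * d1 * d2 * (p' * q' * r' - 1) * (p * p' * (1 - q * q') * (1 - r * r') -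
         (r' * q' - p) * (r * q - p'))); last by rewrite norm_p mulr0.
ring.
Qed.

(** * Matching entries of equal modulus by unimodular factors *)

Section Phases.
Variable C : numClosedFieldType.
Implicit Types p q r u v w : C.

Lemma phase_ratio p u : `|p| = `|u| -> exists2 c : C, c^* * c = 1 & p = u * c.
Proof.
move=> pu; have [u0|u_neq0] := eqVneq u 0.
  exists 1; first by rewrite rmorph1 mulr1.
  by apply/eqP; rewrite u0 mul0r -normr_eq0 pu u0 normr0.
exists (p / u); last by rewrite mulrC divfK.
by rewrite -normCKC normf_div pu divff ?expr1n // normr_eq0.
Qed.

(* With [a = 1], the first two equations determine [b] and [c]; the side
   condition makes the third one follow. It holds up to a cyclic shift. *)
Lemma phase_cycle_open p q r u v w :
  `|p| = `|u| -> `|q| = `|v| -> `|r| = `|w| -> u * v * w = (p * q * r)^* ->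
  (r == 0) || (p != 0) && (q != 0) ->
  exists a b c : C, [/\ a^* * a = 1, b^* * b = 1 & c^* * c = 1] /\
    [/\ p^* = a^* * u * b, q^* = b^* * v * c & r^* = c^* * w * a].
Proof.
move=> pu qv rw uvw pqr.
have [b b1 pb] : exists2 b : C, b^* * b = 1 & p^* = u * b.
  by apply: phase_ratio; rewrite norm_conjC.
have [c c1 qc] : exists2 c : C, c^* * c = 1 & q^* = v * c.
  by apply: phase_ratio; rewrite norm_conjC.
exists 1, b, (b * c); rewrite !rmorph1 !mul1r !mulr1 rmorphM; split.
  by split=> //; rewrite mulrACA b1 c1 mulr1.
split=> //; first by rewrite [RHS]mulrACA b1 mul1r.
case/orP: pqr => [/eqP r0|/andP[p_neq0 q_neq0]].
  have /eqP : `|w| = 0 by rewrite -rw r0 normr0.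
  by rewrite normr_eq0 => /eqP->; rewrite r0 rmorph0 mulr0.
have uv_neq0 : u * v != 0.
  by rewrite mulf_neq0 // -normr_eq0 -?pu -?qv normr_eq0.
apply: (mulfI uv_neq0); rewrite mulrCA uvw !rmorphM /= pb qc.
transitivity ((b^* * b) * (c^* * c) * (u * v) * r^*); last by ring.
by rewrite b1 c1 !mul1r.
Qed.

Lemma phase_cycle p q r u v w :
  `|p| = `|u| -> `|q| = `|v| -> `|r| = `|w| -> u * v * w = (p * q * r)^* ->
  exists a b c : C, [/\ a^* * a = 1, b^* * b = 1 & c^* * c = 1] /\
    [/\ p^* = a^* * u * b, q^* = b^* * v * c & r^* = c^* * w * a].
Proof.
move=> pu qv rw uvw.
have [/orP r0|] := boolP ((r == 0) || (p != 0) && (q != 0)).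
  by apply: phase_cycle_open; rewrite ?r0 //; apply/orP.
(* A cyclic shift moves the vanishing entry, [p] or [q], to the last place. *)
rewrite negb_or negb_and !negbK => /andP[r_neq0 /orP[p0|q0]].
  have [||a [b [c [[? ? ?] [? ? ?]]]]] := phase_cycle_open qv rw pu.
  - by rewrite mulrC mulrA uvw; congr (_^*); ring.
  - by rewrite p0.
  by exists c, a, b.
have [||a [b [c [[? ? ?] [? ? ?]]]]] := phase_cycle_open rw pu qv.
- by rewrite -mulrA mulrC uvw; congr (_^*); ring.
- by rewrite q0.
by exists b, c, a.
Qed.
End Phases.

(** * Gram matrices of size 3 with entries of equal modulus *)

Lemma det_mx33 (R : comNzRingType) (A : 'M[R]_3)
    (a := fun i j : nat => A (inord i) (inord j)) :
  \det A = a 0 0 * (a 1 1 * a 2 2 - a 1 2 * a 2 1)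
         - a 0 1 * (a 1 0 * a 2 2 - a 1 2 * a 2 0)
         + a 0 2 * (a 1 0 * a 2 1 - a 1 1 * a 2 0).
Proof.
have AE i j : A i j = a i j by rewrite /a !inord_val.
rewrite (expand_det_row _ 0) !big_ord_recr big_ord0 /= /cofactor.
rewrite !(expand_det_row _ 0) !big_ord_recr !big_ord0 /= /cofactor !det_mx11 !mxE.
by rewrite !AE /=; ring.
Qed.

(** The product hypothesis makes [H] a diagonal rescaling of the inverse of [G], so Cramer's rule
    expresses its entries through those of [G]. This fixes the triple product of [H], after which
    unimodular phases can be chosen for the three entries above the diagonal up to conjugation. *)
Lemma unit_gram_phase (C : numClosedFieldType) (G H : 'M[C]_3) (d k : 'rV[C]_3) :
  (forall i j, G j i = (G i j)^*) -> (forall i j, H j i = (H i j)^*) ->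
  (forall i, G i i = 1) -> (forall i, H i i = 1) ->
  \det G != 0 -> (forall i, k 0 i * (d 0 i)^* = 1) ->
  H *m diag_mx k *m G = diag_mx d ->
  (forall i j : 'I_3, (i < j)%N -> `|G i j| = `|H i j|) ->
  exists b : 'rV[C]_3, G^c = diag_mx b^c *m H *m diag_mx b.
Proof.
move=> Gh Hh G1 H1 detG kd HkG GH.
pose i0 : 'I_3 := inord 0; pose i1 : 'I_3 := inord 1; pose i2 : 'I_3 := inord 2.
have ord3 (P : 'I_3 -> Prop) : P i0 -> P i1 -> P i2 -> forall i, P i.
  move=> P0 P1 P2 i; rewrite -(inord_val i); case: i => [[|[|[|m]]] lti] //=.
have ord3E (F : 'I_3 -> C) : \sum_i F i = F i0 + F i1 + F i2.
  rewrite !big_ord_recr big_ord0 /= add0r.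
  by congr (F _ + F _ + F _); apply: val_inj; rewrite /= inordK.
have eqn i j : H i i0 * k 0 i0 * G i0 j + H i i1 * k 0 i1 * G i1 j +
    H i i2 * k 0 i2 * G i2 j = d 0 i *+ (i == j).
  by move/matrixP/(_ i j): HkG; rewrite mul_mx_diag !mxE ord3E !mxE.
set p := G i0 i1; set q := G i1 i2; set r := G i2 i0.
pose u := H i0 i1; pose v := H i1 i2; pose w := H i2 i0.
have pC : G i1 i0 = p^* by rewrite Gh.
have qC : G i2 i1 = q^* by rewrite Gh.
have rC : G i0 i2 = r^* by rewrite Gh.
(* This is the determinant of [G]. *)
pose Delta := 1 - p * p^* - q * q^* - r * r^* + p * q * r + p^* * q^* * r^*.
have Delta_neq0 : Delta != 0.
  apply: contraNneq detG => Delta0; rewrite -Delta0 det_mx33 !G1 pC qC rC -/p -/q -/r.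
  by apply/eqP; rewrite /Delta; ring.
have ne01 : i0 != i1 by rewrite -val_eqE /= !inordK.
have ne02 : i0 != i2 by rewrite -val_eqE /= !inordK.
have ne12 : i1 != i2 by rewrite -val_eqE /= !inordK.
(* Row [i0] of [HkG] is a linear system with matrix [G] in the unknowns [H i0 j * k 0 j]. The other
   rows are treated alike after a cyclic shift of [p], [q], [r], which preserves [Delta]. *)
have [k0 hu] : k 0 i0 * Delta = d 0 i0 * (1 - q * q^*) /\
    u * k 0 i1 * Delta = d 0 i0 * (r^* * q^* - p).
  apply: (@cramer3 _ _ _ _ _ _ _ _ _ (H i0 i2 * k 0 i2)).
  - have := eqn i0 i0; rewrite eqxx mulr1n H1 G1 pC -/p -/q -/r -/u -/v -/w.
    by move=> <-; ring.
  - have := eqn i0 i1; rewrite (negPf ne01) mulr0n H1 G1 qC -/p -/q -/r -/u -/v -/w.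
    by move=> <-; ring.
  - have := eqn i0 i2; rewrite (negPf ne02) mulr0n H1 G1 rC -/p -/q -/r -/u -/v -/w.
    by move=> <-; ring.
have [k1 hv] : k 0 i1 * Delta = d 0 i1 * (1 - r * r^*) /\
    v * k 0 i2 * Delta = d 0 i1 * (p^* * r^* - q).
  have -> : Delta = 1 - q * q^* - r * r^* - p * p^* + q * r * p + q^* * r^* * p^*.
    by rewrite /Delta; ring.
  apply: (@cramer3 _ _ _ _ _ _ _ _ _ (H i1 i0 * k 0 i0)).
  - have := eqn i1 i1; rewrite eqxx mulr1n H1 G1 qC -/p -/q -/r -/u -/v -/w.
    by move=> <-; ring.
  - have := eqn i1 i2; rewrite (negPf ne12) mulr0n H1 G1 rC -/p -/q -/r -/u -/v -/w.
    by move=> <-; ring.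
  - have := eqn i1 i0; rewrite eq_sym (negPf ne01) mulr0n H1 G1 pC -/p -/q -/r -/u -/v -/w.
    by move=> <-; ring.
have [k2 hw] : k 0 i2 * Delta = d 0 i2 * (1 - p * p^*) /\
    w * k 0 i0 * Delta = d 0 i2 * (q^* * p^* - r).
  have -> : Delta = 1 - r * r^* - p * p^* - q * q^* + r * p * q + r^* * p^* * q^*.
    by rewrite /Delta; ring.
  apply: (@cramer3 _ _ _ _ _ _ _ _ _ (H i2 i1 * k 0 i1)).
  - have := eqn i2 i2; rewrite eqxx mulr1n H1 G1 rC -/p -/q -/r -/u -/v -/w.
    by move=> <-; ring.
  - have := eqn i2 i0; rewrite eq_sym (negPf ne02) mulr0n H1 G1 pC -/p -/q -/r -/u -/v -/w.
    by move=> <-; ring.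
  - have := eqn i2 i1; rewrite eq_sym (negPf ne12) mulr0n H1 G1 qC -/p -/q -/r -/u -/v -/w.
    by move=> <-; ring.
have d_neq0 i : d 0 i != 0.
  by apply: contra_eq_neq (kd i) => ->; rewrite rmorph0 mulr0 eq_sym oner_neq0.
have k_neq0 i : k 0 i != 0.
  by apply: contra_eq_neq (kd i) => ->; rewrite mul0r eq_sym oner_neq0.
have nz i e : k 0 i * Delta = d 0 i * e -> e != 0.
  move=> ke; apply: contraNneq (mulf_neq0 (k_neq0 i) Delta_neq0) => e0.
  by rewrite ke e0 mulr0.
(* As [k] inverts the conjugate of [d], each diagonal cofactor times the squared modulus of [d 0 i]
   is [Delta]; equating two of these eliminates [k]. *)
have DeltaE i e : k 0 i * Delta = d 0 i * e -> Delta = d 0 i * (d 0 i)^* * e.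
  by move=> ke; rewrite mulrAC -ke mulrAC kd mul1r.
have hu' : u * (d 0 i1 * (1 - r * r^*)) = d 0 i0 * (r^* * q^* - p).
  by rewrite -k1 mulrA.
have norm_pu : `|p| = `|u| by apply: GH; rewrite !inordK.
have norm_qv : `|q| = `|v| by apply: GH; rewrite !inordK.
have norm_rw : `|r| = `|w|.
  by rewrite /r /w Gh Hh !norm_conjC; apply: GH; rewrite !inordK.
have uvw : u * v * w = p^* * q^* * r^*.
  apply: (@dual_triple_product _ p _ q _ r _ u u^* v w
            (d 0 i0) (d 0 i0)^* (d 0 i1) (d 0 i1)^* (d 0 i2)).
  - exact: d_neq0.
  - exact: d_neq0.
  - exact: d_neq0.
  - exact: nz k2.
  - exact: nz k0.
  - exact: nz k1.
  - by rewrite -(DeltaE _ _ k0) -(DeltaE _ _ k1).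
  - by rewrite conjC_eq0.
  - exact: hu'.
  - have := congr1 Num.conj hu'.
    by rewrite !(rmorphM, rmorphB, rmorph1) /= !conjCK [r^* * r]mulrC.
  - by rewrite -k2 mulrA.
  - by rewrite -k0 mulrA.
  - by rewrite -!normCK norm_pu.
have [|a [b [c [[a1 b1 c1] [pE qE rE]]]]] := phase_cycle norm_pu norm_qv norm_rw.
  by rewrite uvw !rmorphM.
pose f := fun i : 'I_3 => if i == i0 then a else if i == i1 then b else c.
have fa : f i0 = a by rewrite /f eqxx.
have fb : f i1 = b by rewrite /f eq_sym (negPf ne01) eqxx.
have fc : f i2 = c by rewrite /f eq_sym (negPf ne02) eq_sym (negPf ne12).
(* Both matrices are Hermitian, so each equation gives its transpose. *)
have fE i j : (G i j)^* = (f i)^* * H i j * f j -> (G j i)^* = (f j)^* * H j i * f i.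
  rewrite (Gh i j) (Hh i j) => ->.
  by rewrite !rmorphM /= conjCK; ring.
exists (\row_i f i); apply/matrixP => i j.
rewrite mul_mx_diag mul_diag_mx !mxE.
move: i j; apply: (ord3); apply: (ord3).
- by rewrite G1 H1 fa rmorph1 mulr1.
- by rewrite fa fb.
- by apply: fE; rewrite fa fc.
- by apply: fE; rewrite fa fb.
- by rewrite G1 H1 fb rmorph1 mulr1.
- by rewrite fb fc.
- by rewrite fa fc.
- by apply: fE; rewrite fb fc.
- by rewrite G1 H1 fc rmorph1 mulr1.
Qed.

(** * Diagonal matrices with distinct entries and independence of eigenvectors *)

Lemma commute_diag_mx (F : fieldType) n (l : 'rV[F]_n) (E : 'M[F]_n) :
  injective (l 0) -> diag_mx l *m E = E *m diag_mx l ->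
  E = diag_mx (\row_i E i i).
Proof.
move=> l_inj /matrixP comm; apply/matrixP => i j; rewrite !mxE.
case: eqVneq => [->|ne_ij]; first by rewrite mulr1n.
have /eqP := comm i j; rewrite mul_diag_mx mul_mx_diag !mxE mulrC -subr_eq0 -mulrBr.
rewrite mulf_eq0 subr_eq0 => /orP[/eqP->|/eqP /l_inj eq_ij]; first by rewrite mulr0n.
by rewrite eq_ij eqxx in ne_ij.
Qed.

(* If [v *m X^T = 0] then [v *m diag(l^k) *m X^T = 0] for all [k], so that
   inverting a Vandermonde matrix yields [diag(v) *m X^T = 0]. *)
Lemma eigenmx_unit (F : fieldType) n (A X : 'M[F]_n) (l : 'rV[F]_n) :
  injective (l 0) -> A *m X = X *m diag_mx l ->
  (forall i, col i X != 0) -> X \in unitmx.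
Proof.
move=> l_inj AX X_neq0; rewrite -unitmx_tr -row_free_unit.
apply: inj_row_free => v vX0.
have XA : X^T *m A^T = diag_mx l *m X^T by rewrite -trmx_mul AX trmx_mul tr_diag_mx.
have vlX0 k : v *m diag_mx (\row_j l 0 j ^+ k) *m X^T = 0.
  elim: k => [|k IHk].
    rewrite (_ : \row_j _ = const_mx 1) ?diag_const_mx ?mulmx1 //.
    by apply/rowP => j; rewrite !mxE.
  rewrite (_ : diag_mx _ = diag_mx (\row_j l 0 j ^+ k) *m diag_mx l).
    by rewrite mulmxA -mulmxA -XA mulmxA IHk mul0mx.
  by rewrite mulmx_diag; congr diag_mx; apply/rowP => j; rewrite !mxE exprSr.
pose M := Vandermonde n l.
have M_unit : M \in unitmx.
  rewrite unitmxE det_Vandermonde unitfE; apply/prodf_neq0 => i _.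
  apply/prodf_neq0 => j lt_ij; rewrite subr_eq0; apply: contraTneq lt_ij => /l_inj->.
  by rewrite ltnn.
have MvX0 : M *m (diag_mx v *m X^T) = 0.
  apply/row_matrixP => k; rewrite row0 -[RHS](vlX0 k) mulmxA row_mul; congr (_ *m _).
  by apply/rowP => j; rewrite mxE !mul_mx_diag !mxE mulrC.
have {}MvX0 : diag_mx v *m X^T = 0 by rewrite -[LHS](mulKmx M_unit) MvX0 mulmx0.
(* Row [j] of [diag_mx v *m X^T] is [v 0 j] times a nonzero eigenvector. *)
apply/rowP => j; rewrite [RHS]mxE; apply: contraNeq (X_neq0 j) => v_neq0.
apply/eqP/colP => i; have /matrixP/(_ j i)/eqP := MvX0.
by rewrite mul_diag_mx !mxE mulf_eq0 (negPf v_neq0) => /eqP.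
Qed.

(** * Symmetric unitary matrices and the Gram criterion *)

Section SymmetricUnitary.
Variables (C : numClosedFieldType) (n : nat).
Implicit Types (T V W X Y : 'M[C]_n).

(* If [V = P^* diag(d) P], then [W = P^* diag(sqrt d) P] is symmetric because
   [V = V^T] means that [P P^T] commutes with [diag(d)], hence with
   [diag(sqrt d)]. *)
Lemma symmetric_unitary_factor V : V \is unitarymx -> V = V^T ->
  exists2 W : 'M[C]_n, W \is unitarymx & V = W *m W^T.
Proof.
move=> V_unitary V_sym.
have V_normal : V \is normalmx.
  by apply/normalmxP; rewrite (unitarymxP V_unitary) (mulmx1C (unitarymxP V_unitary)).
have /orthomx_spectralP := V_normal.
move: (spectral_unitarymx V); set P := spectralmx V; set d := spectral_diag V => P_unitary.
rewrite invmx_unitary // => defV.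
have PPt : P *m P^t* = 1%:M := unitarymxP P_unitary.
have PtP : P^t* *m P = 1%:M := mulmx1C PPt.
have PTPc : P^T *m P^c = 1%:M by rewrite -[RHS]trmx1 -PtP trmx_mul map_trmx trmxK.
have PcPT := mulmx1C PTPc.
pose s : 'rV[C]_n := \row_i sqrtC (d 0 i).
have comm_d : diag_mx d *m (P *m P^T) = P *m P^T *m diag_mx d.
  have VT : V = P^T *m diag_mx d *m P^c.
    by rewrite V_sym defV !trmx_mul tr_diag_mx map_trmx trmxK mulmxA.
  have := erefl (P *m V *m P^T).
  rewrite {1}defV VT !mulmxA PPt mul1mx => ->.
  by rewrite -[LHS]mulmxA PcPT mulmx1.
(* Where an entry of [P *m P^T] is nonzero, the two matching entries of [d] agree, hence so do their
   square roots. *)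
have comm_s : diag_mx s *m (P *m P^T) = P *m P^T *m diag_mx s.
  move: (P *m P^T) comm_d => M /matrixP comm; apply/matrixP => i j.
  move: (comm i j); rewrite !mul_diag_mx !mul_mx_diag !mxE => /eqP.
  rewrite mulrC -subr_eq0 -mulrBr mulf_eq0 subr_eq0 => /orP[/eqP->|/eqP->].
    by rewrite mul0r mulr0.
  exact: mulrC.
have ss_d : diag_mx s *m diag_mx s = diag_mx d.
  by rewrite mulmx_diag; congr diag_mx; apply/rowP => i; rewrite !mxE -expr2 sqrtCK.
have s_unitary : diag_mx s *m (diag_mx s)^t* = 1%:M.
  have d_unitary : diag_mx d *m (diag_mx d)^t* = 1%:M.
    have -> : diag_mx d = P *m V *m P^t*.
      by rewrite defV !mulmxA PPt mul1mx -mulmxA PPt mulmx1.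
    apply/unitarymxP; rewrite !mul_unitarymx ?trmxC_unitary //.
  apply/matrixP => i j; move/matrixP/(_ i j): d_unitary.
  rewrite !tr_diag_mx !map_diag_mx !mulmx_diag !mxE; case: eqVneq => // _.
  rewrite !mulr1n -!normCK => /eqP.
  by rewrite sqrp_eq1 // => /eqP d_unit; rewrite -normrX sqrtCK.
pose W := P^t* *m diag_mx s *m P.
have W_sym : W^T = W.
  rewrite /W !trmx_mul tr_diag_mx map_trmx trmxK.
  (* Inserting [P^t* *m P] on the left brings [P *m P^T] next to [diag_mx s]. *)
  rewrite mulmxA -[in LHS](mul1mx P^T) -PtP -(mulmxA _ P) -(mulmxA _ (P *m _)) -comm_s.
  by rewrite !mulmxA -(mulmxA _ P^T) PTPc mulmx1.
exists W.
  apply/unitarymxP; rewrite /W !trmx_mul !map_mxM trmxCK.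
  rewrite !mulmxA -(mulmxA _ P) PPt mulmx1 -(mulmxA _ (diag_mx s)).
  by rewrite s_unitary mulmx1.
by rewrite W_sym /W !mulmxA -(mulmxA _ P) PPt mulmx1 -(mulmxA (P^t*)) ss_d.
Qed.

Lemma UECSM_symmetric_unitary T :
  UECSM T <-> exists2 V : 'M[C]_n, V \is unitarymx /\ V = V^T & T^t* *m V = V *m T^c.
Proof.
split=> [[S S_sym [U U_unitary defT]]|[V [V_unitary V_sym] TV]].
  have UtU : U^t* *m U = 1%:M := mulmx1C (unitarymxP U_unitary).
  exists (U *m U^T).
    by rewrite mul_unitarymx ?trmx_unitary // trmx_mul trmxK.
  have UTUc : U^T *m U^c = 1%:M by rewrite -[RHS]trmx1 -UtU trmx_mul map_trmx trmxK.
  rewrite {}defT !trmx_mul !map_mxM trmxCK -S_sym.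
  rewrite !mulmxA -(mulmxA _ (U^t*)) UtU mulmx1.
  rewrite -(mulmxA _ U^T) UTUc mulmx1.
  by rewrite map_mxCK.
have [W W_unitary defV] := symmetric_unitary_factor V_unitary V_sym.
have WWt := unitarymxP W_unitary; have WtW := mulmx1C WWt.
have WTWc : W^T *m W^c = 1%:M by rewrite -[RHS]trmx1 -WtW trmx_mul map_trmx trmxK.
exists (W^t* *m T *m W); last first.
  exists W => //.
  by rewrite !mulmxA WWt mul1mx -mulmxA WWt mulmx1.
set S := W^t* *m T *m W.
(* This identity is [TV] multiplied by [W^t*] on the left and [W^c] on the right. *)
suff S_sym : S^t* = S^c by rewrite -[LHS]trmxCK S_sym -map_trmx map_mxCK.
have := congr1 (fun M => W^t* *m M *m W^c) TV.
rewrite /S !trmx_mul !map_mxM trmxCK defV !mulmxA WtW mul1mx map_mxCK.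
by rewrite -(mulmxA _ W^T) WTWc mulmx1.
Qed.

Lemma adjoint_eigenmx T X (l : 'rV[C]_n) :
  T *m X = X *m diag_mx l -> X^t* *m T^t* = diag_mx l^c *m X^t*.
Proof.
by move=> TX; rewrite -map_mxM -trmx_mul TX trmx_mul map_mxM tr_diag_mx map_diag_mx.
Qed.

(** Evaluating [X^t* *m T^t* *m Y] from either side shows that [X^t* *m Y] commutes with
    [diag_mx l^c]: eigenvectors of [T] and [T^t*] are biorthogonal. *)
Lemma dual_eigenmx T X Y (l : 'rV[C]_n) :
  injective (l 0) -> T *m X = X *m diag_mx l -> T^t* *m Y = Y *m diag_mx l^c ->
  exists d : 'rV[C]_n, X^t* *m Y = diag_mx d.
Proof.
move=> l_inj /adjoint_eigenmx XT TY; eexists; apply: (@commute_diag_mx _ _ l^c).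
  by move=> i j; rewrite !mxE => /(can_inj conjCK)/l_inj.
by rewrite mulmxA -XT -!mulmxA TY.
Qed.

(** [V] and [b] determine each other by [V *m X^c = Y *m diag_mx b]. Unitarity of [V] becomes the
    Gram identity; symmetry holds because [X^t* *m V *m X^c] is diagonal, and the intertwining
    relation because [Y] diagonalizes [T^t*]. *)
Lemma UECSM_gram T X Y (l : 'rV[C]_n) :
  injective (l 0) -> X \in unitmx -> Y \in unitmx ->
  T *m X = X *m diag_mx l -> T^t* *m Y = Y *m diag_mx l^c ->
  UECSM T <->
    exists b : 'rV[C]_n,
      (X^t* *m X)^c = diag_mx b^c *m (Y^t* *m Y) *m diag_mx b.
Proof.
move=> l_inj X_unit Y_unit TX TY.
have lc_inj : injective (l^c 0) by move=> i j; rewrite !mxE => /(can_inj conjCK)/l_inj.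
have XT := adjoint_eigenmx TX.
have Xt_unit : X^t* \in unitmx by rewrite map_unitmx unitmx_tr.
have Xc_unit : X^c \in unitmx by rewrite map_unitmx.
have TXc : T^c *m X^c = X^c *m diag_mx l^c by rewrite -map_mxM TX map_mxM map_diag_mx.
have XctE : X^c^t* = X^T by rewrite map_trmx map_mxCK.
have Xct_unit : X^c^t* \in unitmx by rewrite XctE unitmx_tr.
have gramM (Z M : 'M[C]_n) : (Z *m M)^t* *m (Z *m M) = M^t* *m (Z^t* *m Z) *m M.
  by rewrite trmx_mul map_mxM !mulmxA.
have [d defXY] := dual_eigenmx l_inj TX TY.
rewrite UECSM_symmetric_unitary; split=> [[V [V_unitary V_sym] TV]|[b gram]].
  (* The columns of [V *m X^c] are, like those of [Y], eigenvectors of [T^t*] for [l^c]. *)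
  have [e defXV] : exists e : 'rV[C]_n, X^t* *m (V *m X^c) = diag_mx e.
    eexists; apply: (commute_diag_mx lc_inj).
    by rewrite !mulmxA -XT -(mulmxA _ (X^c)) -TXc -!mulmxA (mulmxA (T^t*)) TV !mulmxA.
  have d_unit : diag_mx d \in unitmx by rewrite -defXY unitmx_mul Xt_unit.
  pose b := \row_i (e 0 i / d 0 i).
  have defVX : V *m X^c = Y *m diag_mx b.
    apply: (can_inj (mulKmx Xt_unit)); rewrite defXV mulmxA defXY mulmx_diag.
    congr diag_mx; apply/rowP => i; rewrite !mxE mulrCA divff ?mulr1 //.
    move: d_unit; rewrite unitmxE det_diag unitfE => /prodf_neq0; exact.
  exists b.
  have := gramM V X^c; rewrite (mulmx1C (unitarymxP V_unitary)) mulmx1 XctE.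
  by rewrite defVX gramM tr_diag_mx map_diag_mx map_mxM map_mxCK => ->.
have [V defVX] : exists V, V *m X^c = Y *m diag_mx b.
  by exists (Y *m diag_mx b *m invmx X^c); rewrite mulmxKV.
have VtV : V^t* *m V = 1%:M.
  apply: (can_inj (mulKmx Xct_unit)); apply: (can_inj (mulmxK Xc_unit)).
  rewrite -gramM defVX gramM tr_diag_mx map_diag_mx -gram mulmx1 XctE.
  by rewrite map_mxM map_mxCK.
have V_sym : V = V^T.
  have defXV : X^t* *m V *m X^c = diag_mx d *m diag_mx b.
    by rewrite -mulmxA defVX mulmxA defXY.
  apply: (can_inj (mulKmx Xt_unit)); apply: (can_inj (mulmxK Xc_unit)).
  have := congr1 trmx defXV; rewrite mulmx_diag tr_diag_mx -mulmx_diag -defXV.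
  by rewrite !trmx_mul -!map_trmx trmxK mulmxA => /= <-.
exists V; first by split=> //; apply/unitarymxP/mulmx1C.
apply: (can_inj (mulmxK Xc_unit)).
rewrite -!mulmxA TXc defVX !mulmxA defVX TY -!mulmxA !mulmx_diag.
by congr (_ *m diag_mx _); apply/rowP => i; rewrite !mxE mulrC.
Qed.
End SymmetricUnitary.

(** * From families of unit eigenvectors to matrices *)

Section UnitEigenvectors.
Variables (C : numClosedFieldType) (n : nat).
Implicit Types (T : 'M[C]_n) (x : 'I_n -> 'cV[C]_n) (l : 'I_n -> C).

Lemma gram_inner x i j (X := \matrix_(k, m) x m k 0) :
  (X^t* *m X) i j = inner (x j) (x i).
Proof.
rewrite /inner dotmxE !mxE; apply: eq_bigr => k _.
by rewrite !mxE mulrC.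
Qed.

Lemma inner_conj (u v : 'cV[C]_n) : inner u v = (inner v u)^*.
Proof.
rewrite /inner !dotmxE !mxE rmorph_sum; apply: eq_bigr => k _.
by rewrite !mxE rmorphM /= conjCK mulrC.
Qed.

Lemma unit_eigenvector_inner T a (v : 'cV[C]_n) :
  unit_eigenvector T a v -> inner v v = 1.
Proof. by case=> _ v1; rewrite -[LHS]sqrtCK -/(vnorm v) v1 expr1n. Qed.

Lemma unit_eigenmx T l x (X := \matrix_(k, m) x m k 0) :
  injective l -> (forall i, unit_eigenvector T (l i) (x i)) ->
  T *m X = X *m diag_mx (\row_i l i) /\ X \in unitmx.
Proof.
move=> l_inj eig; have colX i : col i X = x i.
  by apply/colP => k; rewrite !mxE.
have TX : T *m X = X *m diag_mx (\row_i l i).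
  apply/matrixP => k i; have [/colP/(_ k) + _] := eig i.
  by rewrite mul_mx_diag -colX !mxE mulrC => <-; apply: eq_bigr => m _; rewrite !mxE.
split=> //; apply: eigenmx_unit TX _ => [i j|i]; first by rewrite !mxE => /l_inj.
rewrite colX; apply/eqP => x0; have := unit_eigenvector_inner (eig i).
by rewrite x0 /inner dotmxE trmx0 mul0mx mxE => /eqP; rewrite eq_sym oner_eq0.
Qed.
End UnitEigenvectors.

Theorem theorem3 (R : realType) (T : 'M[R[i]]_3)
    (lambda : 'I_3 -> R[i]) (x y : 'I_3 -> 'cV[R[i]]_3)
    (distinct_lambda : injective lambda)
    (eigen_x : forall i : 'I_3, unit_eigenvector T (lambda i) (x i))
    (eigen_y : forall i : 'I_3, unit_eigenvector (T^t*) ((lambda i)^*) (y i)) :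
  UECSM T <->
  (forall i j : 'I_3, (i < j)%N ->
     `|inner (x i) (x j)| = `|inner (y i) (y j)|).
Proof.
have conj_inj : injective (fun i => (lambda i)^*).
  by move=> i j /(can_inj conjCK)/distinct_lambda.
have [TX X_unit] := unit_eigenmx distinct_lambda eigen_x.
have [TY Y_unit] := unit_eigenmx conj_inj eigen_y.
have GE := gram_inner x; have HE := gram_inner y.
have x1 i := unit_eigenvector_inner (eigen_x i).
have y1 i := unit_eigenvector_inner (eigen_y i).
move: GE HE TX X_unit TY Y_unit.
set X := \matrix_(k, m) x m k 0; set Y := \matrix_(k, m) y m k 0; set l := \row_i lambda i.
move=> GE HE TX X_unit + Y_unit.
rewrite (_ : \row_i _ = l^c); last by apply/rowP => i; rewrite !mxE.
move=> TY.
have l_inj : injective (l 0) by move=> i j; rewrite !mxE => /distinct_lambda.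
rewrite (UECSM_gram l_inj X_unit Y_unit TX TY); split=> [[b gram] i j _|xy].
  have gramE k m : (inner (x m) (x k))^* = (b 0 k)^* * inner (y m) (y k) * b 0 m.
    rewrite -GE -HE; have /matrixP/(_ k m) := gram.
    by rewrite mul_mx_diag mul_diag_mx [in LHS]mxE ![in RHS]mxE.
  (* Unit vectors put 1 on both diagonals, which forces [b] to be unimodular. *)
  have b1 k : `|b 0 k| = 1.
    have /eqP := gramE k k.
    by rewrite x1 y1 rmorph1 mulr1 eq_sym -normCKC sqrp_eq1 // => /eqP.
  by rewrite -norm_conjC gramE 2!normrM norm_conjC 2!b1 mulr1 mul1r.
have [e defXY] := dual_eigenmx l_inj TX TY.
have e_neq0 i : e 0 i != 0.
  have : diag_mx e \in unitmx by rewrite -defXY unitmx_mul map_unitmx unitmx_tr X_unit.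
  by rewrite unitmxE det_diag unitfE => /prodf_neq0; apply.
(* This choice makes [Y *m diag_mx k] the inverse of [X^t*], so that H diag(k) G collapses to
   [Y^t* *m X], the adjoint of [diag_mx e]. *)
pose k := \row_i (e 0 i)^-1.
have XYk : X^t* *m (Y *m diag_mx k) = 1%:M.
  rewrite mulmxA defXY mulmx_diag -diag_const_mx; congr diag_mx.
  by apply/rowP => i; rewrite !mxE divff.
apply: (@unit_gram_phase _ _ _ e^c k).
- by move=> i j; rewrite !GE inner_conj.
- by move=> i j; rewrite !HE inner_conj.
- by move=> i; rewrite GE.
- by move=> i; rewrite HE.
- by rewrite -unitfE -unitmxE unitmx_mul map_unitmx unitmx_tr X_unit.
- by move=> i; rewrite !mxE conjCK mulVf.
- rewrite -mulmxA mulmxA -(mulmxA _ Y) -(mulmxA (Y^t*)) (mulmxA _ _ X).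
  rewrite (mulmx1C XYk) mul1mx.
  by rewrite -map_diag_mx -[diag_mx e]tr_diag_mx -defXY trmx_mul map_mxM trmxCK.
- move=> i j ij; rewrite !GE !HE (inner_conj (x j)) (inner_conj (y j)).
  rewrite 2!norm_conjC; exact: xy.
Qed.
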